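(* For the one-dimensional multi-ion GLM-MHD system, let $\hat{\mathbf f}^{\mathrm{EC}}_{(i,j)}$ and $\mathbf\Phi^{\diamond,\mathrm{EC}}_{(i,j)}$ be the two-point numerical flux and the two-point numerical non-conservative term defined in the context. Then: (i) (Consistency and symmetry) $\hat{\mathbf f}^{\mathrm{EC}}_{(i,j)}=\hat{\mathbf f}^{\mathrm{EC}}_{(j,i)}$, $\hat{\mathbf f}^{\mathrm{EC}}_{(i,i)}=\mathbf f(\mathbf u_i)$ and $\mathbf\Phi^{\diamond,\mathrm{EC}}_{(i,i)}=\mathbf\Phi(\mathbf u_i)$. (ii) (Entropy conservation) For all admissible states $\mathbf u_i,\mathbf u_j$ the generalized Tadmor shuffle condition holds: $$[\![\mathbf w]\!]_{(i,j)}^T\,\hat{\mathbf f}^{\mathrm{EC}}_{(i,j)}+\mathbf w_j^T\mathbf\Phi^{\diamond,\mathrm{EC}}_{(j,i)}-\mathbf w_i^T\mathbf\Phi^{\diamond,\mathrm{EC}}_{(i,j)}-[\![\Psi]\!]_{(i,j)}=0 .$$ (iii) (Single-fluid limit) If $N_i=1$, then, writing $\vec v$ for the single ion velocity, the sum of the magnetic and GLM parts of the energy component of $\hat{\mathbf f}^{\mathrm{EC}}_{(i,j)}$ equals $$\{\!\{\vec B\}\!\}\cdot\hat{\vec f}_{\vec B}-\tfrac12\{\!\{v_1\|\vec B\|^2\}\!\}+\{\!\{\vec v\cdot\vec B\}\!\}\{\!\{B_1\}\!\}+\tfrac12\{\!\{v_1\}\!\}\{\!\{\|\vec B\|^2\}\!\}-\{\!\{\vec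 v\}\!\}\cdot\{\!\{\vec B\}\!\}\{\!\{B_1\}\!\}+2c_h\{\!\{\psi\}\!\}\{\!\{B_1\}\!\}-c_h\{\!\{\psi B_1\}\!\},$$ with $\hat{\vec f}_{\vec B}=\big(0,\ \{\!\{v_1\}\!\}\{\!\{B_2\}\!\}-\{\!\{v_2\}\!\}\{\!\{B_1\}\!\},\ \{\!\{v_1\}\!\}\{\!\{B_3\}\!\}-\{\!\{v_3\}\!\}\{\!\{B_1\}\!\}\big)^T$, which is the magnetic and divergence-cleaning energy flux of the entropy-conservative flux of Derigs et al. for the single-fluid GLM-MHD system.
   Context: **State.** $N_i\ge1$ ion species with constants $\gamma_k>1$, $r_k$; $c_h$ a constant. State $\mathbf u=(\rho_k,\rho_k\vec v_k,E_k,\vec B,\psi)$, meaning the $5N_i$ quantities $\rho_k\in\mathbb R$, $\rho_k\vec v_k\in\mathbb R^3$, $E_k\in\mathbb R$ for $k=1,\dots,N_i$ together with $\vec B=(B_1,B_2,B_3)$ and $\psi\in\mathbb R$. Here $E_k=\frac12\rho_k\|\vec v_k\|^2+\frac{p_k}{\gamma_k-1}+\frac12\|\vec B\|^2+\frac12\psi^2$; admissible means $\rho_k,p_k>0$ for all $k$. Define $n_ee=\sum_kr_k\rho_k$ (assumed nonzero), $\vec v^+_k=\frac{r_k\rho_k\vec v_k}{n_ee}$, $\vec v^+=\sum_k\vec v^+_k$, $\vec v^-_k=\vec v^+-\vec v^+_k$, $\beta_k=\frac{\rho_k}{2p_k}$, $\beta_+=\sum_k\beta_k$; $p_e$ (electron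 pressure) is a given function of the state. Vectors below list the components $(\rho_k;\rho_kv_{k,1};\rho_kv_{k,2};\rho_kv_{k,3};E_k;B_1;B_2;B_3;\psi)$, the first five for every $k$. **Entropy.** $s_k=\ln p_k-\gamma_k\ln\rho_k$, $S=\sum_k\frac{-\rho_ks_k}{\gamma_k-1}$, entropy variables $\mathbf w=\partial S/\partial\mathbf u=\big(\frac{\gamma_k-s_k}{\gamma_k-1}-\beta_k\|\vec v_k\|^2;\,2\beta_kv_{k,1};\,2\beta_kv_{k,2};\,2\beta_kv_{k,3};\,-2\beta_k;\,2\beta_+B_1;\,2\beta_+B_2;\,2\beta_+B_3;\,2\beta_+\psi\big)^T$, entropy flux $f^S=\sum_kv_{k,1}\frac{-\rho_ks_k}{\gamma_k-1}$. **Continuous flux in the $x$-direction.** $\mathbf f$ has components $\rho_k$: $\rho_kv_{k,1}$; $\rho_kv_{k,1}$: $\rho_kv_{k,1}^2+p_k$; $\rho_kv_{k,2}$: $\rho_kv_{k,1}v_{k,2}$; $\rho_kv_{k,3}$: $\rho_kv_{k,1}v_{k,3}$; $E_k$: $v_{k,1}\big(\frac12\rho_k\|\vec v_k\|^2+\frac{\gamma_kp_k}{\gamma_k-1}\big)+v^+_{k,1}\|\vec B\|^2-B_1(\vec v^+_k\cdot\vec B)+c_h\psi B_1$; $B_1$: $c_h\psi$; $B_2$: $v^+_1B_2-v^+_2B_1$; $B_3$: $v^+_1B_3-v^+_3B_1$; $\psi$: $c_hB_1$. **Non-derivative version of the non-conservative terms.** $\mathbf\Phi=\boldsymbol\phi^{\mathrm{GP}}B_1+\boldsymbol\phi^{\mathrm{Lor}}\circ\mathbf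 h^{\mathrm{Lor}}+\mathbf\Phi^{\mathrm{multi}}+\boldsymbol\phi^{\mathrm{GLM}}\psi$, where $\circ$ is the componentwise product and - $\boldsymbol\phi^{\mathrm{GP}}=\big(0;\frac{r_k\rho_k}{n_ee}B_1;\frac{r_k\rho_k}{n_ee}B_2;\frac{r_k\rho_k}{n_ee}B_3;\vec v^+\cdot\vec B;v^+_1;v^+_2;v^+_3;0\big)^T$; - $\boldsymbol\phi^{\mathrm{Lor}}=\big(0;\frac{r_k\rho_k}{n_ee};\frac{r_k\rho_k}{n_ee};\frac{r_k\rho_k}{n_ee};v^+_{k,1};0;0;0;0\big)^T$, $\mathbf h^{\mathrm{Lor}}=\big(0;\frac12\|\vec B\|^2-B_1^2+p_e;-B_1B_2;-B_1B_3;p_e;0;0;0;0\big)^T$; - $\mathbf\Phi^{\mathrm{multi}}$ has only $E_k$-components nonzero, equal to $B_2(v^-_{k,1}B_2-v^-_{k,2}B_1)+B_3(v^-_{k,1}B_3-v^-_{k,3}B_1)$; - $\boldsymbol\phi^{\mathrm{GLM}}$ has $E_k$-components $v^+_1\psi$, $\psi$-component $v^+_1$, and zeros elsewhere. **Entropy potential.** $\Psi=\mathbf w^T(\mathbf f+\mathbf\Phi)-f^S$. **Averages.** For states $\mathbf u_i,\mathbf u_j$ and a quantity $a$: $[\![a]\!]_{(i,j)}=a_j-a_i$, $\{\!\{a\}\!\}=\frac12(a_i+a_j)$, $a^{\ln}=[\![a]\!]/[\![\ln a]\!]$ (and $a^{\ln}=a_i$ if $a_i=a_j$). $\bar p_e$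 is any symmetric two-point average of $p_e$ that equals $p_e(\mathbf u_i)$ for $\mathbf u_i=\mathbf u_j$. $\overline p_k=\frac{\{\!\{\rho_k\}\!\}}{2\{\!\{\beta_k\}\!\}}$. **Numerical flux** $\hat{\mathbf f}^{\mathrm{EC}}_{(i,j)}$, componentwise: $\rho_k$: $\hat f_{\rho_k}=\rho_k^{\ln}\{\!\{v_{k,1}\}\!\}$; $\rho_kv_{k,1}$: $\hat f_{\rho_kv_{k,1}}=\rho_k^{\ln}\{\!\{v_{k,1}\}\!\}^2+\overline p_k$; $\rho_kv_{k,2}$: $\hat f_{\rho_kv_{k,2}}=\rho_k^{\ln}\{\!\{v_{k,1}\}\!\}\{\!\{v_{k,2}\}\!\}$; $\rho_kv_{k,3}$: $\hat f_{\rho_kv_{k,3}}=\rho_k^{\ln}\{\!\{v_{k,1}\}\!\}\{\!\{v_{k,3}\}\!\}$; $E_k$: $\hat f^{\mathrm{Euler}}_{E_k}+\hat f^{\mathrm{mMHD}}_{E_k}+2c_h\{\!\{\psi\}\!\}\{\!\{B_1\}\!\}-c_h\{\!\{\psi B_1\}\!\}$ (the second summand is the magnetic part, the last two the GLM part); $B_1$: $c_h\{\!\{\psi\}\!\}$; $B_2$: $\{\!\{v^+_1\}\!\}\{\!\{B_2\}\!\}-\{\!\{v^+_2\}\!\}\{\!\{B_1\}\!\}$; $B_3$: $\{\!\{v^+_1\}\!\}\{\!\{B_3\}\!\}-\{\!\{v^+_3\}\!\}\{\!\{B_1\}\!\}$; $\psi$: $c_h\{\!\{B_1\}\!\}$.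 Here $$\hat f^{\mathrm{Euler}}_{E_k}=\hat f_{\rho_k}\Big[\frac{1}{2(\gamma_k-1)\beta_k^{\ln}}-\frac12\{\!\{\|\vec v_k\|^2\}\!\}\Big]+\sum_{m=1}^3\hat f_{\rho_kv_{k,m}}\{\!\{v_{k,m}\}\!\},$$ $$\hat f^{\mathrm{mMHD}}_{E_k}=\{\!\{\vec B\}\!\}\cdot\hat{\vec f}^{\,\mathrm{mMHD}}_{\vec B}-\tfrac12\{\!\{v^+_{k,1}\|\vec B\|^2\}\!\}+\{\!\{\vec v^+_k\cdot\vec B\}\!\}\{\!\{B_1\}\!\}+\tfrac12\{\!\{v^+_{k,1}\}\!\}\{\!\{\|\vec B\|^2\}\!\}-\{\!\{\vec v^+_k\}\!\}\cdot\{\!\{\vec B\}\!\}\{\!\{B_1\}\!\}-\{\!\{\vec B\}\!\}\cdot\vec h_k,$$ $$\hat{\vec f}^{\,\mathrm{mMHD}}_{\vec B}=\big(0,\ \{\!\{v^+_1\}\!\}\{\!\{B_2\}\!\}-\{\!\{v^+_2\}\!\}\{\!\{B_1\}\!\},\ \{\!\{v^+_1\}\!\}\{\!\{B_3\}\!\}-\{\!\{v^+_3\}\!\}\{\!\{B_1\}\!\}\big)^T,\qquad \vec h_k=\{\!\{\vec B\}\!\}\{\!\{v^-_{k,1}\}\!\}-\{\!\{\vec v^-_k\}\!\}\{\!\{B_1\}\!\}.$$ **Numerical non-conservative term** $\mathbf\Phi^{\diamond,\mathrm{EC}}_{(i,j)}$ is the sum of: $\boldsymbol\phi^{\mathrm{GP}}(\mathbf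 u_i)\{\!\{B_1\}\!\}$; $\boldsymbol\phi^{\mathrm{Lor}}(\mathbf u_i)\circ\big(0;\frac12\{\!\{\|\vec B\|^2\}\!\}-\{\!\{B_1\}\!\}^2+\bar p_e;-\{\!\{B_1\}\!\}\{\!\{B_2\}\!\};-\{\!\{B_1\}\!\}\{\!\{B_3\}\!\};\bar p_e;0;0;0;0\big)^T$; the vector whose only nonzero components are the $E_k$-components $\vec B_i\cdot\vec h_k$; and $\boldsymbol\phi^{\mathrm{GLM}}(\mathbf u_i)\{\!\{\psi\}\!\}$. (All averages are between $\mathbf u_i$ and $\mathbf u_j$.) *)

(* Defs.v *)
(* MathComp-Analysis, over an abstract R : realType. *)
From mathcomp Require Import all_boot all_order all_algebra.
From mathcomp Require Import all_classical all_reals all_analysis.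
From mathcomp Require Import ring.
Set Implicit Arguments.
Unset Strict Implicit.
Unset Printing Implicit Defensive.
Import Order.TTheory GRing.Theory Num.Theory.
Import numFieldNormedType.Exports.
Local Open Scope ring_scope.

(* Components of a state or flux vector with N ion species. *)
Inductive component (N : nat) : Type :=
| CRho of 'I_N
| CMom of 'I_N & 'I_3
| CEner of 'I_N
| CMag of 'I_3
| CPsi.
Arguments CMag {N} _.
Arguments CPsi {N}.

(* Vectors with 5 N + 4 components.  A state lists the conserved variables, so
   the velocities and pressures are derived quantities. *)
Definition cvec (R : realType) (N : nat) : Type := component N -> R.

(* The spatial directions 1, 2, 3, counted from 0 in 'I_3. *)
Definition i1 : 'I_3 := @Ordinal 3 0 isT.
Definition i2 : 'I_3 := @Ordinal 3 1 isT.
Definition i3 : 'I_3 := @Ordinal 3 2 isT.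

Section Model.
Context {R : realType} {N : nat}.
Local Notation state := (cvec R N).
Local Notation vec := (cvec R N).
Implicit Types (u : state) (a b : vec) (x y : 'I_3 -> R) (k : 'I_N) (m : 'I_3).

Definition vec3 (x1 x2 x3 : R) : 'I_3 -> R := fun m => [:: x1; x2; x3]`_m.
Definition dot3 x y : R := \sum_(m < 3) x m * y m.
Definition normsq x : R := \sum_(m < 3) x m ^+ 2.

Definition dot a b : R :=
  \sum_(k < N) (a (CRho k) * b (CRho k)
                + \sum_(m < 3) a (CMom k m) * b (CMom k m)
                + a (CEner k) * b (CEner k))
  + \sum_(m < 3) a (CMag m) * b (CMag m)
  + a CPsi * b CPsi.
Definition vadd a b : vec := fun c => a c + b c.
Definition vsub a b : vec := fun c => a c - b c.
Definition vhad a b : vec := fun c => a c * b c.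
Definition vscale (s : R) a : vec := fun c => s * a c.

Variables (gamma r : 'I_N -> R) (ch : R).

Definition rho u k : R := u (CRho k).
Definition vel u k m : R := u (CMom k m) / rho u k.
Definition mag u m : R := u (CMag m).
Definition psi u : R := u CPsi.

(* Solves the definition of E_k for p_k. *)
Definition pres u k : R :=
  (gamma k - 1) * (u (CEner k) - 2^-1 * rho u k * normsq (vel u k)
                   - 2^-1 * normsq (mag u) - 2^-1 * psi u ^+ 2).

Definition admissible u : Prop := forall k, 0 < rho u k /\ 0 < pres u k.

Definition nee u : R := \sum_(k < N) r k * rho u k.
Definition vplusk u k m : R := r k * rho u k * vel u k m / nee u.
Definition vplus u m : R := \sum_(k < N) vplusk u k m.
Definition vminusk u k m : R := vplus u m - vplusk u k m.
Definition beta u k : R := rho u k / (2 * pres u k).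
Definition betaplus u : R := \sum_(k < N) beta u k.

Definition physical u : Prop := admissible u /\ nee u != 0.

Definition sk u k : R := ln (pres u k) - gamma k * ln (rho u k).
Definition entropy u : R :=
  \sum_(k < N) - (rho u k * sk u k) / (gamma k - 1).

(* The gradient of entropy, see entropy_vars_gradient below. *)
Definition entropy_vars u : vec := fun c =>
  match c with
  | CRho k => (gamma k - sk u k) / (gamma k - 1) - beta u k * normsq (vel u k)
  | CMom k m => 2 * beta u k * vel u k m
  | CEner k => - (2 * beta u k)
  | CMag m => 2 * betaplus u * mag u m
  | CPsi => 2 * betaplus u * psi u
  end.

Definition entropy_flux u : R :=
  \sum_(k < N) vel u k i1 * (- (rho u k * sk u k) / (gamma k - 1)).

Definition flux u : vec := fun c =>
  match c with
  | CRho k => rho u k * vel u k i1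
  | CMom k m => vec3 (rho u k * vel u k i1 ^+ 2 + pres u k)
                     (rho u k * vel u k i1 * vel u k i2)
                     (rho u k * vel u k i1 * vel u k i3) m
  | CEner k =>
      vel u k i1 * (2^-1 * rho u k * normsq (vel u k)
                    + gamma k * pres u k / (gamma k - 1))
      + vplusk u k i1 * normsq (mag u)
      - mag u i1 * dot3 (vplusk u k) (mag u)
      + ch * psi u * mag u i1
  | CMag m => vec3 (ch * psi u)
                   (vplus u i1 * mag u i2 - vplus u i2 * mag u i1)
                   (vplus u i1 * mag u i3 - vplus u i3 * mag u i1) m
  | CPsi => ch * mag u i1
  end.

Definition phiGP u : vec := fun c =>
  match c with
  | CRho _ => 0
  | CMom k m => r k * rho u k / nee u * mag u m
  | CEner _ => dot3 (vplus u) (mag u)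
  | CMag m => vplus u m
  | CPsi => 0
  end.

Definition phiLor u : vec := fun c =>
  match c with
  | CRho _ => 0
  | CMom k _ => r k * rho u k / nee u
  | CEner k => vplusk u k i1
  | CMag _ => 0
  | CPsi => 0
  end.

Definition phiGLM u : vec := fun c =>
  match c with
  | CRho _ => 0
  | CMom _ _ => 0
  | CEner _ => vplus u i1 * psi u
  | CMag _ => 0
  | CPsi => vplus u i1
  end.

Definition hLor (pe : state -> R) u : vec := fun c =>
  match c with
  | CRho _ => 0
  | CMom _ m => vec3 (2^-1 * normsq (mag u) - mag u i1 ^+ 2 + pe u)
                     (- (mag u i1 * mag u i2))
                     (- (mag u i1 * mag u i3)) m
  | CEner _ => pe u
  | CMag _ => 0
  | CPsi => 0
  end.

Definition Phimulti u : vec := fun c =>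
  match c with
  | CEner k =>
      mag u i2 * (vminusk u k i1 * mag u i2 - vminusk u k i2 * mag u i1)
      + mag u i3 * (vminusk u k i1 * mag u i3 - vminusk u k i3 * mag u i1)
  | _ => 0
  end.

Definition Phi (pe : state -> R) u : vec :=
  vadd (vadd (vadd (vscale (mag u i1) (phiGP u))
                   (vhad (phiLor u) (hLor pe u)))
             (Phimulti u))
       (vscale (psi u) (phiGLM u)).

Definition entropy_potential (pe : state -> R) u : R :=
  dot (entropy_vars u) (vadd (flux u) (Phi pe u)) - entropy_flux u.

Section TwoPoint.
Variables (ui uj : state).

Definition avg (q : state -> R) : R := 2^-1 * (q ui + q uj).
Definition logavg (q : state -> R) : R :=
  if q ui == q uj then q ui else (q uj - q ui) / (ln (q uj) - ln (q ui)).

Local Notation "'{{' q '}}_' u" := (avg (fun u : state => q))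
  (at level 0, q at level 200, u name).
Local Notation "'{{' q '}}ln_' u" := (logavg (fun u : state => q))
  (at level 0, q at level 200, u name).

Definition presbar k : R := {{ rho u k }}_u / (2 * {{ beta u k }}_u).

Definition fec_rho k : R := {{ rho u k }}ln_u * {{ vel u k i1 }}_u.

Definition fec_mom k : 'I_3 -> R :=
  vec3 ({{ rho u k }}ln_u * {{ vel u k i1 }}_u ^+ 2 + presbar k)
       ({{ rho u k }}ln_u * {{ vel u k i1 }}_u * {{ vel u k i2 }}_u)
       ({{ rho u k }}ln_u * {{ vel u k i1 }}_u * {{ vel u k i3 }}_u).

Definition fec_E_Euler k : R :=
  fec_rho k * (1 / (2 * (gamma k - 1) * {{ beta u k }}ln_u)
               - 2^-1 * {{ normsq (vel u k) }}_u)
  + \sum_(m < 3) fec_mom k m * {{ vel u k m }}_u.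

Definition fec_B_mMHD : 'I_3 -> R :=
  vec3 0
       ({{ vplus u i1 }}_u * {{ mag u i2 }}_u
        - {{ vplus u i2 }}_u * {{ mag u i1 }}_u)
       ({{ vplus u i1 }}_u * {{ mag u i3 }}_u
        - {{ vplus u i3 }}_u * {{ mag u i1 }}_u).

Definition hec k m : R :=
  {{ mag u m }}_u * {{ vminusk u k i1 }}_u
  - {{ vminusk u k m }}_u * {{ mag u i1 }}_u.

Definition fec_E_mMHD k : R :=
  dot3 (fun m => {{ mag u m }}_u) fec_B_mMHD
  - 2^-1 * {{ vplusk u k i1 * normsq (mag u) }}_u
  + {{ dot3 (vplusk u k) (mag u) }}_u * {{ mag u i1 }}_u
  + 2^-1 * {{ vplusk u k i1 }}_u * {{ normsq (mag u) }}_u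
  - dot3 (fun m => {{ vplusk u k m }}_u) (fun m => {{ mag u m }}_u)
    * {{ mag u i1 }}_u
  - dot3 (fun m => {{ mag u m }}_u) (hec k).

Definition fec_E_GLM : R :=
  2 * ch * {{ psi u }}_u * {{ mag u i1 }}_u - ch * {{ psi u * mag u i1 }}_u.

Definition flux_EC : vec := fun c =>
  match c with
  | CRho k => fec_rho k
  | CMom k m => fec_mom k m
  | CEner k => fec_E_Euler k + fec_E_mMHD k + fec_E_GLM
  | CMag m => vec3 (ch * {{ psi u }}_u)
                   ({{ vplus u i1 }}_u * {{ mag u i2 }}_u
                    - {{ vplus u i2 }}_u * {{ mag u i1 }}_u)
                   ({{ vplus u i1 }}_u * {{ mag u i3 }}_u
                    - {{ vplus u i3 }}_u * {{ mag u i1 }}_u) m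
  | CPsi => ch * {{ mag u i1 }}_u
  end.

Definition hLor_EC (pebar : state -> state -> R) : vec := fun c =>
  match c with
  | CRho _ => 0
  | CMom _ m => vec3 (2^-1 * {{ normsq (mag u) }}_u - {{ mag u i1 }}_u ^+ 2
                      + pebar ui uj)
                     (- ({{ mag u i1 }}_u * {{ mag u i2 }}_u))
                     (- ({{ mag u i1 }}_u * {{ mag u i3 }}_u)) m
  | CEner _ => pebar ui uj
  | CMag _ => 0
  | CPsi => 0
  end.

Definition Phimulti_EC : vec := fun c =>
  match c with
  | CEner k => dot3 (mag ui) (hec k)
  | _ => 0
  end.

Definition Phi_EC (pebar : state -> state -> R) : vec :=
  vadd (vadd (vadd (vscale {{ mag u i1 }}_u (phiGP ui))
                   (vhad (phiLor ui) (hLor_EC pebar)))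
             Phimulti_EC)
       (vscale {{ psi u }}_u (phiGLM ui)).

(* Magnetic flux and the magnetic plus divergence-cleaning part of the energy
   flux of the single-fluid GLM-MHD system (Derigs et al.), for the velocity
   field v. *)
Definition sf_fluxB (v : state -> 'I_3 -> R) : 'I_3 -> R :=
  vec3 0
       ({{ v u i1 }}_u * {{ mag u i2 }}_u - {{ v u i2 }}_u * {{ mag u i1 }}_u)
       ({{ v u i1 }}_u * {{ mag u i3 }}_u - {{ v u i3 }}_u * {{ mag u i1 }}_u).

Definition sf_fluxE_mag_GLM (v : state -> 'I_3 -> R) : R :=
  dot3 (fun m => {{ mag u m }}_u) (sf_fluxB v)
  - 2^-1 * {{ v u i1 * normsq (mag u) }}_u
  + {{ dot3 (v u) (mag u) }}_u * {{ mag u i1 }}_u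
  + 2^-1 * {{ v u i1 }}_u * {{ normsq (mag u) }}_u
  - dot3 (fun m => {{ v u m }}_u) (fun m => {{ mag u m }}_u) * {{ mag u i1 }}_u
  + 2 * ch * {{ psi u }}_u * {{ mag u i1 }}_u
  - ch * {{ psi u * mag u i1 }}_u.

End TwoPoint.

End Model.

(* Derivative of the entropy in an arbitrary direction d. *)
Lemma entropy_vars_gradient (R : realType) (N : nat) (gamma : 'I_N -> R)
    (u d : cvec R N) :
  (forall k, 1 < gamma k) -> admissible gamma u ->
  is_derive (0 : R) (1 : R) (fun t : R => entropy gamma (vadd u (vscale t d)))
    (dot (entropy_vars gamma u) d).
Proof.
move=> hg hu.
have dc c : is_derive (0 : R) (1 : R) (fun t : R => vadd u (vscale t d) c) (d c).
  rewrite /vadd /vscale.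
  have -> : (fun t : R => u c + t * d c) = cst (u c) + d c \*: (id : R -> R).
    by apply/funext => t; rewrite !fctE /GRing.scale /= mulrC.
  by apply: is_derive_eq; rewrite add0r /GRing.scale /= mulr1.
have dX2 (f : R -> R) df : is_derive (0 : R) (1 : R) f df ->
    is_derive (0 : R) (1 : R) (fun t => f t ^+ 2) (2 * f 0 * df).
  move=> h; have := is_deriveX 2 h.
  by rewrite /GRing.scale /= expr1 mulr_natl.
have dM (f g : R -> R) df dg : is_derive (0 : R) (1 : R) f df ->
    is_derive (0 : R) (1 : R) g dg ->
    is_derive (0 : R) (1 : R) (fun t => f t * g t) (df * g 0 + f 0 * dg).
  by move=> hf hh; apply: is_derive_eq; rewrite /GRing.scale /= addrC mulrC.
have dS n (f : 'I_n -> R -> R) df :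
    (forall i, is_derive (0 : R) (1 : R) (f i) (df i)) ->
    is_derive (0 : R) (1 : R) (fun t => \sum_(i < n) f i t) (\sum_(i < n) df i).
  move=> h; have -> : (fun t => \sum_(i < n) f i t) = \sum_(i < n) f i.
    by apply/funext => t; rewrite fct_sumE.
  exact: is_derive_sum.
have dZ (a : R) (f : R -> R) df : is_derive (0 : R) (1 : R) f df ->
    is_derive (0 : R) (1 : R) (fun t => a * f t) (a * df).
  exact: is_deriveZ.
have dB (f g : R -> R) df dg : is_derive (0 : R) (1 : R) f df ->
    is_derive (0 : R) (1 : R) g dg ->
    is_derive (0 : R) (1 : R) (fun t => f t - g t) (df - dg).
  by move=> hf hh; apply: is_deriveB.
have dln (f : R -> R) df : is_derive (0 : R) (1 : R) f df -> 0 < f 0 ->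
    is_derive (0 : R) (1 : R) (fun t => ln (f t)) (df / f 0).
  move=> hf f0; have hl := is_derive1_ln f0.
  by apply: is_derive_eq (is_derive1_comp hl hf) _; rewrite mulrC.
have u0 : vadd u (vscale 0 d) = u.
  by apply/funext => c; rewrite /vadd /vscale mul0r addr0.
pose dv k m := (d (CMom k m) - vel u k m * d (CRho k)) / rho u k.
have hv k m : is_derive (0 : R) (1 : R)
    (fun t => vel (vadd u (vscale t d)) k m) (dv k m).
  have [r0 _] := hu k.
  have rn : (fun t => rho (vadd u (vscale t d)) k) 0 != 0 :> R.
    by rewrite /= u0 gt_eqF.
  have := dM _ _ _ _ (dc (CMom k m)) (@is_deriveV _ (fun t => rho (vadd u (vscale t d)) k) _ _ _ rn (dc (CRho k))).
  move=> h; apply: is_derive_eq h _.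
  rewrite /= u0 /GRing.scale /= /dv /vel.
  have : rho u k != 0 by rewrite gt_eqF.
  by move=> h; field.
have hn2 (f : R -> 'I_3 -> R) df :
    (forall m, is_derive (0 : R) (1 : R) (fun t => f t m) (df m)) ->
    is_derive (0 : R) (1 : R) (fun t => normsq (f t))
      (\sum_(m < 3) 2 * f 0 m * df m).
  by move=> h; apply: dS => m; apply: dX2.
pose dp k := (gamma k - 1) *
  (d (CEner k)
   - (2^-1 * d (CRho k) * normsq (vel u k)
      + 2^-1 * rho u k * \sum_(m < 3) 2 * vel u k m * dv k m)
   - 2^-1 * \sum_(m < 3) 2 * mag u m * d (CMag m)
   - 2^-1 * (2 * psi u * d CPsi)).
have hp k : is_derive (0 : R) (1 : R)
    (fun t => pres gamma (vadd u (vscale t d)) k) (dp k).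
  apply: (@dZ (gamma k - 1)).
  have h1 := dZ 2^-1 _ _ (hn2 _ _ (fun m => dc (CMag m))).
  have h2 := dZ 2^-1 _ _ (dX2 _ _ (dc CPsi)).
  have h3 := dM _ _ _ _ (dZ 2^-1 _ _ (dc (CRho k))) (hn2 _ _ (hv k)).
  have := dB _ _ _ _ (dB _ _ _ _ (dB _ _ _ _ (dc (CEner k)) h3) h1) h2.
  by rewrite /= u0.
pose ds k := - (gamma k - 1)^-1 * (d (CRho k) * sk gamma u k
  + rho u k * (dp k / pres gamma u k - gamma k * (d (CRho k) / rho u k))).
have hS k : is_derive (0 : R) (1 : R)
    (fun t => - (rho (vadd u (vscale t d)) k * sk gamma (vadd u (vscale t d)) k)
              / (gamma k - 1)) (ds k).
  have [r0 p0] := hu k.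
  have l1 := dln _ _ (hp k); rewrite /= u0 in l1.
  have l2 := dln _ _ (dc (CRho k)); rewrite /= u0 in l2.
  have := dM _ _ _ _ (dc (CRho k)) (dB _ _ _ _ (l1 p0) (dZ (gamma k) _ _ (l2 r0))).
  move/(dZ (- (gamma k - 1)^-1)); rewrite /= u0.
  suff -> : (fun t => - (rho (vadd u (vscale t d)) k
      * sk gamma (vadd u (vscale t d)) k) / (gamma k - 1)) =
    (fun t => - (gamma k - 1)^-1 * (vadd u (vscale t d) (CRho k)
      * sk gamma (vadd u (vscale t d)) k)) by [].
  by apply/funext => t; rewrite mulrC mulrN mulNr.
apply: is_derive_eq (dS _ _ _ hS) _.
rewrite /dot /= /betaplus.
have -> : \sum_(m < 3) 2 * (\sum_(k < N) beta gamma u k) * mag u m * d (CMag m)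
    = \sum_(k < N) 2 * beta gamma u k * \sum_(m < 3) mag u m * d (CMag m).
  rewrite -mulr_suml -mulr_sumr [RHS]mulr_sumr.
  by apply: eq_bigr => m _; rewrite mulrA.
have -> : 2 * (\sum_(k < N) beta gamma u k) * psi u * d CPsi
    = \sum_(k < N) 2 * beta gamma u k * psi u * d CPsi.
  by rewrite -!mulr_suml -mulr_sumr.
rewrite -!big_split; apply: eq_bigr => k _ /=.
have [r0 p0] := hu k.
have g0 : gamma k - 1 != 0 by rewrite gt_eqF// subr_gt0.
have {}r0 : rho u k != 0 by rewrite gt_eqF.
have {}p0 : pres gamma u k != 0 by rewrite gt_eqF.
rewrite /ds /dp /dv /normsq /beta !big_ord_recl !big_ord0.
move: (pres _ _ _) (sk _ _ _) p0 => p s p0; field.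
by rewrite ?g0 ?r0 ?p0.
Qed.

(* Main.v *)
Require Import Defs.
From mathcomp Require Import all_boot all_order all_algebra.
From mathcomp Require Import all_classical all_reals all_analysis.
From mathcomp Require Import ring.
Import Order.TTheory GRing.Theory Num.Theory.
Local Open Scope ring_scope.

(** Symmetry and consistency of the flux come from those of the averages it is
    built from, plus algebra on the diagonal.

    For entropy conservation, the key observation is that the shuffle condition
    holds species by species.  The magnetic and psi entropy variables carry the
    factor betaplus, a sum over the species; distributing it over the species
    ([dot_entropy_vars]) makes every term of the condition a sum over k, in
    which the coupling enters only through the values of vplus, which are
    then arbitrary vectors.  Each summand is the sum of two independent
    identities.

    - The Euler part ([Euler_shuffle]).  Since p = rho / (2 beta), the
      first entropy variable is, up to a constant,
      ln rho + ln beta / (gamma - 1) - beta |v|^2.  The logarithmic means of rho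
      and beta turn the jumps of both logarithms into algebraic ones: the jump
      of ln beta cancels against the energy flux, and that of ln rho produces
      the jump of rho v_1.

    - The magnetic and GLM part ([magnetic_shuffle]), a polynomial identity.
      It is small because most of the non-conservative term does no entropy work
      ([species_dot_Phi_EC]): electron pressure, the product
      of vplus with B and the GLM term each appear in the energy component and
      in one other component, with cancelling work.

    What remains on the right are the jumps of the two parts of the
    entropy potential, whose closed form is [entropy_potentialE].

    For one species, n_e e is r rho, so vplus is the ion
    velocity and vminus vanishes. *)

(** * Finite sums *)

Lemma sum_singleton {R : realType} {n : nat} (k : 'I_n) (F : 'I_n -> R) :
  n = 1%N -> \sum_(l < n) F l = F k.
Proof. by move=> n1; subst n; rewrite big_ord1 (ord1 k). Qed.

Lemma sum3E {R : realType} (f : 'I_3 -> R) : \sum_(m < 3) f m = f i1 + f i2 + f i3.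
Proof.
rewrite !big_ord_recl big_ord0 addr0 addrA.
by congr (f _ + f _ + f _); apply: val_inj.
Qed.

Lemma ord3P (P : 'I_3 -> Prop) : P i1 -> P i2 -> P i3 -> forall m, P m.
Proof.
move=> P1 P2 P3 [[|[|[|m]]] lt_m3] //.
- by rewrite (_ : Ordinal lt_m3 = i1)//; apply: val_inj.
- by rewrite (_ : Ordinal lt_m3 = i2)//; apply: val_inj.
- by rewrite (_ : Ordinal lt_m3 = i3)//; apply: val_inj.
Qed.

(** * Two-point averages *)

Section TwoPointAverages.
Context {R : realType} {N : nat}.
Implicit Types (u ui uj : cvec R N) (q : cvec R N -> R).

Lemma avgC ui uj : avg ui uj = avg uj ui.
Proof. by apply/funext => q; rewrite /avg addrC. Qed.

Lemma avg_diag u q : avg u u q = q u.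
Proof. by rewrite /avg; field. Qed.

Lemma logavgC ui uj : logavg ui uj = logavg uj ui.
Proof.
apply/funext => q; rewrite /logavg eq_sym.
case: eqP => [->//|_].
by rewrite -[q uj - q ui]opprB -[ln (q uj) - _]opprB invrN mulrNN.
Qed.

Lemma logavg_diag u q : logavg u u q = q u.
Proof. by rewrite /logavg eqxx. Qed.

(** Both branches of the logarithmic mean obey this equation, which spares the
    later algebra any case distinction. *)
Lemma logavgM ui uj q : 0 < q ui -> 0 < q uj ->
  logavg ui uj q * (ln (q uj) - ln (q ui)) = q uj - q ui.
Proof.
move=> qi0 qj0; rewrite /logavg; case: eqVneq => [->|neq].
  by rewrite !subrr mulr0.
rewrite divfK// subr_eq0; apply: contra neq => /eqP lneq.
by apply/eqP; apply: ln_inj; rewrite ?posrE.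
Qed.

(** A vanishing mean would force the two values to agree, and then the mean is
    their common positive value. *)
Lemma logavg_neq0 ui uj q : 0 < q ui -> 0 < q uj -> logavg ui uj q != 0.
Proof.
move=> qi0 qj0; apply/negP => /eqP l0.
have /esym/eqP := logavgM ui uj q qi0 qj0; rewrite l0 mul0r subr_eq0 => /eqP qji.
by move: l0; rewrite /logavg qji eqxx => /eqP; rewrite gt_eqF.
Qed.

Lemma logavgV ui uj q : 0 < q ui -> 0 < q uj ->
  (q uj - q ui) / logavg ui uj q = ln (q uj) - ln (q ui).
Proof.
by move=> qi0 qj0; rewrite -logavgM// mulrC mulKf// logavg_neq0.
Qed.

End TwoPointAverages.

(** * Entropy products, species by species *)

Section Model.
Context {R : realType} {N : nat}.
Variables (gamma r : 'I_N -> R) (ch : R).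
Implicit Types (u ui uj : cvec R N) (a b c : cvec R N) (k : 'I_N).

Lemma dot_subl a b c : dot (vsub a b) c = dot a c - dot b c.
Proof.
rewrite /dot /vsub !sum3E mulrBl.
have -> : \sum_(k < N) ((a (CRho k) - b (CRho k)) * c (CRho k)
     + \sum_(m < 3) (a (CMom k m) - b (CMom k m)) * c (CMom k m)
     + (a (CEner k) - b (CEner k)) * c (CEner k)) =
   \sum_(k < N) (a (CRho k) * c (CRho k)
     + \sum_(m < 3) a (CMom k m) * c (CMom k m) + a (CEner k) * c (CEner k))
   - \sum_(k < N) (b (CRho k) * c (CRho k)
     + \sum_(m < 3) b (CMom k m) * c (CMom k m) + b (CEner k) * c (CEner k)).
  by rewrite -sumrB; apply: eq_bigr => k _; rewrite !sum3E; ring.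
by ring.
Qed.

(** The share of species k in the product with the entropy variables: the
    magnetic and psi variables carry beta of species k where the full
    product has betaplus. *)
Definition species_dot u k c : R :=
  entropy_vars gamma u (CRho k) * c (CRho k)
  + (\sum_(m < 3) 2 * beta gamma u k * vel u k m * c (CMom k m)
     - 2 * beta gamma u k * c (CEner k)
     + 2 * beta gamma u k * (\sum_(m < 3) mag u m * c (CMag m) + psi u * c CPsi)).

Lemma dot_entropy_vars u c :
  dot (entropy_vars gamma u) c = \sum_(k < N) species_dot u k c.
Proof.
have -> : \sum_(k < N) species_dot u k c =
    \sum_(k < N) (entropy_vars gamma u (CRho k) * c (CRho k)
      + \sum_(m < 3) entropy_vars gamma u (CMom k m) * c (CMom k m)
      + entropy_vars gamma u (CEner k) * c (CEner k))
    + 2 * betaplus gamma u * (\sum_(m < 3) mag u m * c (CMag m) + psi u * c CPsi).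
  rewrite /betaplus mulr_sumr mulr_suml -big_split /=.
  by apply: eq_bigr => k _; rewrite /species_dot !sum3E /=; ring.
by rewrite /dot !sum3E /=; ring.
Qed.

Lemma species_dotD u k a b :
  species_dot u k (vadd a b) = species_dot u k a + species_dot u k b.
Proof. by rewrite /species_dot /vadd !sum3E; ring. Qed.

Lemma pos_neq0 u k : admissible gamma u -> rho u k != 0 /\ pres gamma u k != 0.
Proof. by move=> /(_ k)[r0 p0]; rewrite !gt_eqF. Qed.

Lemma beta_gt0 u k : admissible gamma u -> 0 < beta gamma u k.
Proof. by move=> /(_ k)[r0 p0]; rewrite divr_gt0// mulr_gt0. Qed.

(** * Symmetry and consistency *)

Lemma flux_ECC ui uj : flux_EC gamma r ch ui uj = flux_EC gamma r ch uj ui.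
Proof.
by rewrite /flux_EC /fec_E_GLM /fec_E_mMHD /hec /fec_B_mMHD /fec_E_Euler /fec_mom
  /fec_rho /presbar (avgC ui uj) (logavgC ui uj).
Qed.

Lemma flux_EC_diag u : (forall k, 1 < gamma k) -> admissible gamma u ->
  flux_EC gamma r ch u u = flux gamma r ch u.
Proof.
move=> gamma_gt1 adm; apply/funext => -[k|k|k||] /=; last first.
- by rewrite !avg_diag.
- by apply: ord3P; rewrite /vec3 /= !avg_diag.
- have [r0 p0] := pos_neq0 u k adm.
  have g0 : gamma k - 1 != 0 by rewrite gt_eqF// subr_gt0.
  rewrite /fec_E_GLM /fec_E_mMHD /hec /fec_B_mMHD /fec_E_Euler /fec_mom
    /fec_rho /presbar /dot3 !sum3E /vec3 /= !avg_diag !logavg_diag.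
  rewrite /dot3 /normsq /vminusk /beta !sum3E.
  by field; rewrite r0 p0 g0.
- have [r0 p0] := pos_neq0 u k adm.
  by apply: ord3P; rewrite /fec_mom /vec3 /presbar /= !avg_diag logavg_diag // /beta;
    field; rewrite r0 p0.
- by rewrite /fec_rho avg_diag logavg_diag.
Qed.

Lemma Phi_EC_diag pe pebar u : pebar u u = pe u -> Phi_EC r u u pebar = Phi r pe u.
Proof.
move=> pebarE; apply/funext => -[k|k|k||];
  rewrite /Phi_EC /Phi /vadd /vscale /vhad /=; last first.
- by rewrite !avg_diag.
- by move=> m; rewrite !avg_diag.
- rewrite /hec /dot3 !sum3E pebarE !avg_diag.
  by ring.
- by apply: ord3P; rewrite /vec3 /= !avg_diag ?pebarE.
- by rewrite !avg_diag.
Qed.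

(** The Lorentz force works at the velocity v_k in the momentum components, and
    r rho v_k / (n_e e) is vplusk; its electron pressure part is therefore
    returned by the energy component.  The GLM work cancels between the energy
    and psi components, and so does the product of vplus with B between the
    energy and magnetic ones.  The remaining Godunov-Powell work is the first
    term on the right. *)
Lemma species_dot_Phi_EC ui uj pebar k :
  species_dot ui k (Phi_EC r ui uj pebar) =
  2 * beta gamma ui k *
    (dot3 (vplusk r ui k) (mag ui) * avg ui uj (fun u => mag u i1)
     + 2^-1 * vplusk r ui k i1 * avg ui uj (fun u => normsq (mag u))
     - dot3 (vplusk r ui k) (fun m => avg ui uj (fun u => mag u m))
       * avg ui uj (fun u => mag u i1)
     - dot3 (mag ui) (hec r ui uj k)).
Proof.
rewrite /species_dot /Phi_EC /vadd /vscale /vhad /= /vec3 /dot3 !sum3E /=.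
by rewrite /vplusk; ring.
Qed.

(** * Entropy conservation *)

Lemma lnpres u k : admissible gamma u ->
  ln (pres gamma u k) = ln (rho u k) - ln 2 - ln (beta gamma u k).
Proof.
move=> adm; have [r0 p0] := adm k; have b0 := beta_gt0 u k adm.
have -> : pres gamma u k = rho u k / 2 / beta gamma u k.
  by rewrite /beta; field; rewrite !gt_eqF.
have rho2_gt0 : 0 < rho u k / 2 by rewrite divr_gt0.
by rewrite ln_div ?posrE// [ln (_ / 2)]ln_div ?posrE.
Qed.

(** In the variables rho and beta the two logarithms separate, each with a
    coefficient that does not depend on the state. *)
Lemma entropy_vars_rho u k : 1 < gamma k -> admissible gamma u ->
  entropy_vars gamma u (CRho k) =
  ln (rho u k) + ln (beta gamma u k) / (gamma k - 1)
  + (gamma k + ln 2) / (gamma k - 1) - beta gamma u k * normsq (vel u k).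
Proof.
move=> g1 adm; have g0 : gamma k - 1 != 0 by rewrite gt_eqF// subr_gt0.
by rewrite /= /sk lnpres//; field.
Qed.

(** The jump of ln rho times the logarithmic mean of rho is the jump of rho.  The
    jump of ln beta in the mass component is cancelled by the internal energy
    in the energy flux, which carries the inverse of the mean of beta.  The
    pressure average has the mean of beta as denominator so that its work
    supplies the average of rho times the jump of v_1. *)
Lemma Euler_shuffle ui uj k : 1 < gamma k ->
    admissible gamma ui -> admissible gamma uj ->
  (entropy_vars gamma uj (CRho k) - entropy_vars gamma ui (CRho k))
    * fec_rho ui uj k
  + \sum_(m < 3) 2 * (beta gamma uj k * vel uj k m - beta gamma ui k * vel ui k m)
      * fec_mom gamma ui uj k m
  - 2 * (beta gamma uj k - beta gamma ui k) * fec_E_Euler gamma ui uj k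
  = rho uj k * vel uj k i1 - rho ui k * vel ui k i1.
Proof.
move=> g1 admi admj; rewrite !entropy_vars_rho//.
have g0 : gamma k - 1 != 0 by rewrite gt_eqF// subr_gt0.
have [[ri0 _] [rj0 _]] := (admi k, admj k).
have bi0 := beta_gt0 ui k admi; have bj0 := beta_gt0 uj k admj.
have Lr := logavgM ui uj (fun u => rho u k) ri0 rj0.
have Lb := logavgV ui uj (fun u => beta gamma u k) bi0 bj0.
have b0 := logavg_neq0 ui uj (fun u => beta gamma u k) bi0 bj0.
have bb0 : beta gamma ui k + beta gamma uj k != 0 by rewrite gt_eqF// addr_gt0.
rewrite /= in Lr Lb b0; move/eqP: Lr; rewrite eq_sym subr_eq => /eqP Lr.
move/esym/eqP: Lb; rewrite subr_eq => /eqP ->.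
rewrite /fec_E_Euler /fec_mom /fec_rho /presbar /normsq !sum3E /vec3 /=.
(* The logarithms of rho are abstracted first: the coming substitution for rho
   must not reach inside them. *)
move: Lr; move: (ln (rho uj k)) (ln (rho ui k)) => lrj lri Lr.
rewrite /avg {}Lr /normsq !sum3E.
move: b0 bb0; move: (logavg _ _ _) (logavg _ _ _) (beta _ _ _) (beta _ _ _).
by move=> rl bl bi bj b0 bb0; field; rewrite b0 g0 bb0.
Qed.

(** The potential splits into a gas-dynamic part rho_k v_(k,1) and a magnetic part
    free of vplus: the shared induction flux is balanced by the work of vminus,
    leaving only the ion's own vplusk. *)
Lemma entropy_potentialE pe u : (forall k, 1 < gamma k) -> admissible gamma u ->
  entropy_potential gamma r ch pe u =
  \sum_(k < N) (rho u k * vel u k i1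
                + beta gamma u k * (vplusk r u k i1 * normsq (mag u)
                                    + 2 * ch * psi u * mag u i1)).
Proof.
move=> gamma_gt1 adm; rewrite /entropy_potential dot_entropy_vars -sumrB.
apply: eq_bigr => k _.
(* On the diagonal the non-conservative term is its numerical version for any
   average that extends pe, for instance the one ignoring its first state. *)
rewrite -(@Phi_EC_diag pe (fun _ => pe))// species_dotD species_dot_Phi_EC.
rewrite /hec /dot3 !sum3E !avg_diag.
have [r0 p0] := pos_neq0 u k adm.
have g0 : gamma k - 1 != 0 by rewrite gt_eqF// subr_gt0.
rewrite /species_dot /= /vec3 /dot3 /normsq /vminusk !sum3E /=.
by rewrite /beta; field; rewrite p0 g0.
Qed.

(** A polynomial identity in the values of vplus, vplusk, B, psi and beta at
    the two states: the correction hec, which enters the energy flux with the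
    average of B and the non-conservative term with the local B, replaces the
    induction by vplus with that of species k. *)
Lemma magnetic_shuffle ui uj pebar k :
  2 * beta gamma uj k
    * (\sum_(m < 3) mag uj m * flux_EC gamma r ch ui uj (CMag m)
       + psi uj * flux_EC gamma r ch ui uj CPsi)
  - 2 * beta gamma ui k
    * (\sum_(m < 3) mag ui m * flux_EC gamma r ch ui uj (CMag m)
       + psi ui * flux_EC gamma r ch ui uj CPsi)
  - 2 * (beta gamma uj k - beta gamma ui k)
      * (fec_E_mMHD r ui uj k + fec_E_GLM ch ui uj)
  + species_dot uj k (Phi_EC r uj ui pebar)
  - species_dot ui k (Phi_EC r ui uj pebar)
  = beta gamma uj k * (vplusk r uj k i1 * normsq (mag uj)
                       + 2 * ch * psi uj * mag uj i1)
    - beta gamma ui k * (vplusk r ui k i1 * normsq (mag ui)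
                         + 2 * ch * psi ui * mag ui i1).
Proof.
rewrite !species_dot_Phi_EC /flux_EC /fec_E_mMHD /fec_E_GLM /fec_B_mMHD /hec /vec3.
rewrite /avg /vminusk /normsq /dot3 !sum3E /=.
by field.
Qed.

Lemma Tadmor_shuffle pe pebar ui uj : (forall k, 1 < gamma k) ->
    admissible gamma ui -> admissible gamma uj ->
  dot (vsub (entropy_vars gamma uj) (entropy_vars gamma ui))
      (flux_EC gamma r ch ui uj)
  + dot (entropy_vars gamma uj) (Phi_EC r uj ui pebar)
  - dot (entropy_vars gamma ui) (Phi_EC r ui uj pebar)
  = entropy_potential gamma r ch pe uj - entropy_potential gamma r ch pe ui.
Proof.
move=> gamma_gt1 admi admj.
rewrite !entropy_potentialE// dot_subl !dot_entropy_vars.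
rewrite -!sumrB -big_split /= -sumrB; apply: eq_bigr => k _.
rewrite [RHS](_ : _ = (rho uj k * vel uj k i1 - rho ui k * vel ui k i1)
  + (beta gamma uj k * (vplusk r uj k i1 * normsq (mag uj)
                       + 2 * ch * psi uj * mag uj i1)
    - beta gamma ui k * (vplusk r ui k i1 * normsq (mag ui)
                         + 2 * ch * psi ui * mag ui i1))); last by ring.
rewrite -(Euler_shuffle ui uj k)// -(magnetic_shuffle ui uj pebar k).
move: (species_dot _ _ (Phi_EC _ _ _ _)) (species_dot _ _ (Phi_EC _ _ _ _)) => si sj.
by rewrite /species_dot !sum3E /=; ring.
Qed.


(** * Single-fluid limit *)

Lemma vplusk_single u k : N = 1%N -> nee r u != 0 -> vplusk r u k = vel u k.
Proof.
move=> N1; rewrite /nee (sum_singleton k)// => nee0.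
apply/funext => m; rewrite /vplusk /nee (sum_singleton k)//.
by rewrite mulrAC divff// mul1r.
Qed.

Lemma vplus_single u k : N = 1%N -> vplus r u = vplusk r u k.
Proof. by move=> N1; apply/funext => m; rewrite /vplus (sum_singleton k). Qed.

Lemma single_fluid_fec_E ui uj k : N = 1%N ->
    nee r ui != 0 -> nee r uj != 0 ->
  fec_E_mMHD r ui uj k + fec_E_GLM ch ui uj
  = sf_fluxE_mag_GLM ch ui uj (fun u => vel u k).
Proof.
move=> N1 neei neej.
rewrite /fec_E_mMHD /hec /fec_B_mMHD /fec_E_GLM /sf_fluxE_mag_GLM /sf_fluxB.
rewrite /vminusk /avg !(vplus_single _ k N1) !(vplusk_single _ k N1)//.
rewrite /dot3 !sum3E /vec3 /=; ring.
Qed.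

End Model.

Theorem mainTheorem4 (R : realType) (N : nat) (gamma r : 'I_N -> R) (ch : R)
    (pe : cvec R N -> R) (pebar : cvec R N -> cvec R N -> R) :
  (1 <= N)%N ->
  (forall k, 1 < gamma k) ->
  (forall ui uj, physical gamma r ui -> physical gamma r uj ->
     pebar ui uj = pebar uj ui) ->
  (forall u, physical gamma r u -> pebar u u = pe u) ->
  [/\ (* (i) *)
      (forall ui uj, physical gamma r ui -> physical gamma r uj ->
         flux_EC gamma r ch ui uj = flux_EC gamma r ch uj ui)
      /\ (forall u, physical gamma r u ->
            flux_EC gamma r ch u u = flux gamma r ch u
            /\ Phi_EC r u u pebar = Phi r pe u),
      (* (ii) *)
      (forall ui uj, physical gamma r ui -> physical gamma r uj ->
         dot (vsub (entropy_vars gamma uj) (entropy_vars gamma ui))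
             (flux_EC gamma r ch ui uj)
         + dot (entropy_vars gamma uj) (Phi_EC r uj ui pebar)
         - dot (entropy_vars gamma ui) (Phi_EC r ui uj pebar)
         - (entropy_potential gamma r ch pe uj
            - entropy_potential gamma r ch pe ui) = 0)
    & (* (iii) *)
      (N = 1%N -> forall k ui uj,
         physical gamma r ui -> physical gamma r uj ->
         fec_E_mMHD r ui uj k + fec_E_GLM ch ui uj
         = sf_fluxE_mag_GLM ch ui uj (fun u => vel u k))].
Proof.
move=> _ gamma_gt1 _ pebar_diag; split; first split.
- by move=> ui uj _ _; exact: flux_ECC.
- move=> u [adm nee0]; split; first exact: flux_EC_diag.
  by apply: Phi_EC_diag; exact: pebar_diag.
- move=> ui uj [admi _] [admj _].
  by apply/eqP; rewrite subr_eq0; apply/eqP; exact: Tadmor_shuffle.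
- by move=> N1 k ui uj [_ neei] [_ neej]; exact: single_fluid_fec_E.
Qed.
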